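(* Let $n\ge 3$, let $i,j,k\in\{1,\dots,n\}$ be distinct, and let $\beta\in PB_n$ be a Brunnian braid, i.e. $p_m(\beta)=1$ for every $m\in\{1,\dots,n\}$. Then $w_{(i,j,k)}(\phi_n(\beta))=1$ in $F_n^3$.
   Context: **Pure braid group.** $PB_n$ is the pure braid group on $n$ strands, with its standard generators $b_{ij}$, $1\le i<j\le n$, and defining relations: $b_{ij}b_{kl}=b_{kl}b_{ij}$ for $i<j<k<l$ or $i<k<l<j$; $b_{ij}b_{ik}b_{jk}=b_{ik}b_{jk}b_{ij}=b_{jk}b_{ij}b_{ik}$ for $i<j<k$; $b_{jl}b_{kl}b_{ik}b_{jk}=b_{kl}b_{ik}b_{jk}b_{jl}$ for $i<j<k<l$. **Strand deletion.** For $m\in\{1,\dots,n\}$ let $s_m:\{1,\dots,n\}\setminus\{m\}\to\{1,\dots,n-1\}$ be the order-preserving bijection. The homomorphism $p_m:PB_n\to PB_{n-1}$ (deletion of the $m$-th strand) is given by $p_m(b_{ij})=1$ if $m\in\{i,j\}$ and $p_m(b_{ij})=b_{s_m(i)s_m(j)}$ otherwise. **The group $G_n^3$.** $G_n^3$ is the group with generators $a_{ijk}=a_{\{i,j,k\}}$ indexed by the $3$-element subsets of $\{1,\dots,n\}$ (the order of the indices is irrelevant), subject to: (1) $a_{ijk}^2=1$; (2) $a_{ijk}a_{stu}=a_{stu}a_{ijk}$ if $|\{i,j,k\}\cap\{s,t,u\}|<2$; (3) $a_{ijk}a_{ijl}a_{ikl}a_{jkl}=a_{jkl}a_{ikl}a_{ijl}a_{ijk}$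 for all distinct $i,j,k,l$. **The homomorphism $\phi_n$.** For $1\le i<j\le n$ put $$c^n_{i,j}=\prod_{k=j+1}^{n}a_{ijk}\prod_{\substack{1\le k\le j-1\\ k\ne i}}a_{ijk}\in G_n^3,$$ factors being written from left to right in increasing order of $k$. The homomorphism $\phi_n:PB_n\to G_n^3$ is defined on generators by $$\phi_n(b_{ij})=(c^n_{i,i+1})^{-1}(c^n_{i,i+2})^{-1}\cdots(c^n_{i,j-1})^{-1}(c^n_{i,j})^2c^n_{i,j-1}\cdots c^n_{i,i+2}c^n_{i,i+1};$$ it is known to be well defined. Each generator $a_{stu}$ occurs an even number of times in (any word representing) an element of the image of $\phi_n$; elements of $G_n^3$ with this property are said to be in good condition. **The invariant $w_{(i,j,k)}$.** Fix distinct $i,j,k\in\{1,\dots,n\}$. Let $F_n^3$ be the group generated by all maps $\sigma:\{1,\dots,n\}\setminus\{i,j,k\}\to\mathbb{Z}_2\times\mathbb{Z}_2$ with relations $\sigma^2=1$ for each $\sigma$ (a free product of $2^{2(n-3)}$ copies of $\mathbb{Z}_2$). Given a word in the generators of $G_n^3$ representing an element in good condition, let $c_1,\dots,c_r$ be the occurrences of the letter $a_{ijk}$ in it, from left to right. For an occurrence $c$ of $a_{ijk}$ and $l\notin\{i,j,k\}$ set $$i_c(l)=(N_{jkl}+N_{ijl},\,N_{ikl}+N_{ijl})\in\mathbb{Z}_2\times\mathbb{Z}_2,$$ where $N_{xyz}$ is the number of occurrences of $a_{xyz}$ before $c$ in the word. Then $i_c$ is a generator of $F_n^3$, and $w_{(i,j,k)}$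 of the word is $i_{c_1}i_{c_2}\cdots i_{c_r}\in F_n^3$. It is known that this depends only on the element of $G_n^3$ represented. *)

(* Defs.v *)
From HB Require Import structures.
From mathcomp Require Import all_boot all_order all_algebra.
From mathcomp Require Import boolp.

Set Implicit Arguments.
Unset Strict Implicit.
Unset Printing Implicit Defensive.

Local Open Scope quotient_scope.
Local Open Scope group_scope.

(** * Groups given by generators and relations *)

(* The letter (x, false) is the generator x, the letter (x, true) its inverse. *)
Definition word (T : Type) := seq (T * bool).

Definition positive (T : Type) (s : seq T) : word T :=
  [seq (x, false) | x <- s].

Definition winv (T : Type) (u : word T) : word T :=
  rev [seq (x.1, ~~ x.2) | x <- u].

Definition eval_word (T : Type) (G : groupType) (f : T -> G) (u : word T) : G :=
  \prod_(x <- u) (if x.2 then (f x.1)^-1 else f x.1).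

(* The least congruence on words that contains R and the free cancellations. *)
Inductive word_eq (T : Type) (R : word T -> word T -> Prop) :
    word T -> word T -> Prop :=
| word_eq_refl u : word_eq R u u
| word_eq_sym u v : word_eq R u v -> word_eq R v u
| word_eq_trans u v w : word_eq R u v -> word_eq R v w -> word_eq R u w
| word_eq_free p q x e :
    word_eq R (p ++ [:: (x, e); (x, ~~ e)] ++ q) (p ++ q)
| word_eq_rel p q u v : R u v -> word_eq R (p ++ u ++ q) (p ++ v ++ q).

Section Presented.
Variables (T : choiceType) (R : word T -> word T -> Prop).

Definition word_eqb (u v : word T) : bool := `[< word_eq R u v >].

Lemma word_eqb_refl : reflexive word_eqb.
Proof. by move=> u; apply/asboolP; apply: word_eq_refl. Qed.

Lemma word_eqb_sym : symmetric word_eqb.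
Proof. by move=> u v; apply/asboolP/asboolP; apply: word_eq_sym. Qed.

Lemma word_eqb_trans : transitive word_eqb.
Proof.
move=> v u w /asboolP uv /asboolP vw; apply/asboolP.
exact: word_eq_trans uv vw.
Qed.

Canonical word_equiv : equiv_rel (word T) :=
  EquivRel word_eqb word_eqb_refl word_eqb_sym word_eqb_trans.

Definition presented : Type := {eq_quot word_equiv}.

HB.instance Definition _ := Choice.on presented.
HB.instance Definition _ := EqQuotient.on presented.

Definition wclass (u : word T) : presented := \pi_presented u.

Lemma wclassP u v : wclass u = wclass v <-> word_eq R u v.
Proof.
split; first by move/eqmodP/asboolP.
by move=> uv; apply/eqmodP/asboolP.
Qed.

Lemma wclassK x : wclass (repr x) = x.
Proof. exact: reprK. Qed.

Lemma word_eq_catl p u v : word_eq R u v -> word_eq R (p ++ u) (p ++ v).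
Proof.
elim=> [{}u|{}u {}v _|{}u {}v w _ uv _|a q x e|a q {}u {}v uv].
- exact: word_eq_refl.
- exact: word_eq_sym.
- exact: word_eq_trans.
- by rewrite 2!(catA p a); apply: word_eq_free.
- by rewrite 2!(catA p a); apply: word_eq_rel.
Qed.

Lemma word_eq_catr q u v : word_eq R u v -> word_eq R (u ++ q) (v ++ q).
Proof.
elim=> [{}u|{}u {}v _|{}u {}v w _ uv _|a b x e|a b {}u {}v uv].
- exact: word_eq_refl.
- exact: word_eq_sym.
- exact: word_eq_trans.
- by rewrite -!catA; apply: word_eq_free.
- by rewrite -!catA; apply: word_eq_rel.
Qed.

Lemma winv_cat (u v : word T) : winv (u ++ v) = winv v ++ winv u.
Proof. by rewrite /winv map_cat rev_cat. Qed.

Lemma winvK (u : word T) : winv (winv u) = u.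
Proof.
rewrite /winv map_rev revK -map_comp -[RHS]map_id.
by apply: eq_map => -[x e] /=; rewrite negbK.
Qed.

Lemma word_eq_mulwV u : word_eq R (u ++ winv u) [::].
Proof.
elim: u => [|[x e] u IHu]; first exact: word_eq_refl.
rewrite -cat1s winv_cat -catA (catA u).
apply: word_eq_trans (word_eq_catl _ (word_eq_catr _ IHu)) _.
exact: (word_eq_free R [::] [::] x e).
Qed.

Definition pmul (x y : presented) : presented := wclass (repr x ++ repr y).
Definition pinv (x : presented) : presented := wclass (winv (repr x)).

Lemma wclass_reprE u : word_eq R (repr (wclass u)) u.
Proof. by apply/wclassP; rewrite wclassK. Qed.

Lemma pmulE u v : pmul (wclass u) (wclass v) = wclass (u ++ v).
Proof.
apply/wclassP; apply: word_eq_trans (word_eq_catr _ (wclass_reprE u)) _.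
exact: word_eq_catl (wclass_reprE v).
Qed.

Lemma pmulA : associative pmul.
Proof.
move=> x y z; rewrite -(wclassK x) -(wclassK y) -(wclassK z).
by rewrite !pmulE catA.
Qed.

Lemma pmul1 : left_id (wclass [::]) pmul.
Proof. by move=> x; rewrite -(wclassK x) pmulE. Qed.

Lemma pmulr1 : right_id (wclass [::]) pmul.
Proof. by move=> x; rewrite -(wclassK x) pmulE cats0. Qed.

Lemma pmulV : right_inverse (wclass [::]) pinv pmul.
Proof.
move=> x; rewrite -{1}(wclassK x) /pinv pmulE.
exact/wclassP/word_eq_mulwV.
Qed.

Lemma pmulVr : left_inverse (wclass [::]) pinv pmul.
Proof.
move=> x; rewrite -{2}(wclassK x) /pinv pmulE -{2}(winvK (repr x)).
exact/wclassP/word_eq_mulwV.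
Qed.

HB.instance Definition _ :=
  isGroup.Build presented pmulA pmul1 pmulr1 pmulVr pmulV.

Definition pgen (x : T) : presented := wclass [:: (x, false)].

Lemma wclass_cat u v : wclass (u ++ v) = wclass u * wclass v.
Proof. by rewrite [RHS]pmulE. Qed.

Lemma wclass_nil : wclass [::] = 1.
Proof. by []. Qed.

Lemma wclassE u : wclass u = eval_word pgen u.
Proof.
elim: u => [|[x e] u IHu]; first by rewrite /eval_word big_nil.
rewrite -cat1s wclass_cat IHu /eval_word big_cons /=; congr (_ * _).
case: e => //; apply: (mulgI (pgen x)); rewrite mulgV -wclass_cat.
exact/wclassP/(word_eq_free R [::] [::] x false).
Qed.

Lemma presented_rel u v : R u v -> wclass u = wclass v.
Proof.
move=> uv; apply/wclassP.
by have := word_eq_rel [::] [::] uv; rewrite !cat0s !cats0.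
Qed.

Section Lift.
Variables (G : groupType) (f : T -> G).

Lemma eval_word_cat (u v : word T) :
  eval_word f (u ++ v) = eval_word f u * eval_word f v.
Proof. exact: big_cat. Qed.

(* The homomorphism determined by images of the generators that satisfy the
   relations. *)
Definition pres_lift of (forall u v, R u v -> eval_word f u = eval_word f v) :=
  fun x : presented => eval_word f (repr x).

Hypothesis fR : forall u v, R u v -> eval_word f u = eval_word f v.

Lemma eval_word_eq u v : word_eq R u v -> eval_word f u = eval_word f v.
Proof.
elim=> {u v} // [u v w _ -> _ -> //|p q x e|p q u v /fR uv].
  rewrite !eval_word_cat; congr (_ * _).
  rewrite -[RHS]mul1g; congr (_ * _); rewrite /eval_word big_cons big_seq1 /=.
  by case: e => /=; rewrite ?mulVg ?mulgV.
by rewrite !eval_word_cat uv.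
Qed.

Lemma pres_lift_wclass u : pres_lift fR (wclass u) = eval_word f u.
Proof. exact/eval_word_eq/wclass_reprE. Qed.

Lemma pres_lift_pgen x : pres_lift fR (pgen x) = f x.
Proof. by rewrite pres_lift_wclass /eval_word big_seq1. Qed.

Lemma pres_lift_morph : {morph pres_lift fR : x y / x / y}.
Proof.
have liftM : {morph pres_lift fR : x y / x * y}.
  move=> x y; rewrite -(wclassK x) -(wclassK y) -wclass_cat.
  by rewrite !pres_lift_wclass eval_word_cat.
move=> x y; rewrite liftM; congr (_ * _); apply: (mulgI (pres_lift fR y)).
by rewrite -liftM !mulgV -wclass_nil pres_lift_wclass /eval_word big_nil.
Qed.

HB.instance Definition _ :=
  isGroupMorphism.Build presented G (pres_lift fR) pres_lift_morph.

End Lift.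

End Presented.

(** * The pure braid group *)

Definition braid_gen (n : nat) := {p : 'I_n * 'I_n | p.1 < p.2}.

Definition bgen n (i j : 'I_n) (ij : i < j) : braid_gen n :=
  exist (fun p : 'I_n * 'I_n => p.1 < p.2) (i, j) ij.

Inductive braid_rel n : word (braid_gen n) -> word (braid_gen n) -> Prop :=
| braid_rel_comm (i j k l : 'I_n) (ij : i < j) (kl : k < l) :
    (j < k) || (i < k) && (l < j) ->
    braid_rel (positive [:: bgen ij; bgen kl])
              (positive [:: bgen kl; bgen ij])
| braid_rel_three1 (i j k : 'I_n) (ij : i < j) (jk : j < k) (ik : i < k) :
    braid_rel (positive [:: bgen ij; bgen ik; bgen jk])
              (positive [:: bgen ik; bgen jk; bgen ij])
| braid_rel_three2 (i j k : 'I_n) (ij : i < j) (jk : j < k) (ik : i < k) :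
    braid_rel (positive [:: bgen ik; bgen jk; bgen ij])
              (positive [:: bgen jk; bgen ij; bgen ik])
| braid_rel_four (i j k l : 'I_n) (ij : i < j) (jk : j < k) (kl : k < l)
      (ik : i < k) (jl : j < l) :
    braid_rel (positive [:: bgen jl; bgen kl; bgen ik; bgen jk])
              (positive [:: bgen kl; bgen ik; bgen jk; bgen jl]).

Definition PB (n : nat) := presented (@braid_rel n).

Definition PB_class n (u : word (braid_gen n)) : PB n := wclass (@braid_rel n) u.

(* [unlift m] is the order-preserving bijection s_m, with value None at m.  In
   the innermost match the value 1 is never used. *)
Definition del_gen n (m : 'I_n) (g : braid_gen n) : PB n.-1 :=
  match unlift m (val g).1, unlift m (val g).2 with
  | Some i, Some j => if insub (i, j) is Some g' then pgen _ g' else 1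
  | _, _ => 1
  end.

Lemma del_gen_left n (m i j : 'I_n) (ij : i < j) :
  unlift m i = None -> del_gen m (bgen ij) = 1.
Proof. by rewrite /del_gen /= => ->. Qed.

Lemma del_gen_right n (m i j : 'I_n) (ij : i < j) :
  unlift m j = None -> del_gen m (bgen ij) = 1.
Proof. by rewrite /del_gen /= => ->; case: unlift. Qed.

Lemma del_gen_keep n (m i j : 'I_n) (ij : i < j) (i' j' : 'I_n.-1)
    (ij' : i' < j') :
  unlift m i = Some i' -> unlift m j = Some j' ->
  del_gen m (bgen ij) = pgen _ (bgen ij').
Proof.
rewrite /del_gen /= => -> ->; case: insubP => [g _ gE|]; last by rewrite ij'.
by congr pgen; apply: val_inj.
Qed.

Lemma unlift_ltn n (m i j : 'I_n) (i' j' : 'I_n.-1) :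
  unlift m i = Some i' -> unlift m j = Some j' -> (i' < j') = (i < j).
Proof.
case: unliftP => // a -> [<-]; case: unliftP => // b -> [<-].
by rewrite /= !ltnNge leq_bump2.
Qed.

Lemma del_gen_rel n (m : 'I_n) (u v : word (braid_gen n)) :
  braid_rel u v -> eval_word (del_gen m) u = eval_word (del_gen m) v.
Proof.
have rel1 (N : nat) (x y : word (braid_gen N)) : braid_rel x y ->
    eval_word (pgen (@braid_rel N)) x = eval_word (pgen (@braid_rel N)) y.
  by move=> xy; rewrite -!wclassE; apply: presented_rel.
have monoE (a b : 'I_n) (a' b' : 'I_n.-1) : a < b ->
    unlift m a = Some a' -> unlift m b = Some b' -> a' < b'.
  by move=> ab ha hb; rewrite (unlift_ltn ha hb).
case=> [i j k l ij kl H|i j k ij jk ik|i j k ij jk ik|i j k l ij jk kl ik jl];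
  rewrite /eval_word !big_map !big_cons !big_nil /= !mulg1.
- case Ei: (unlift m i) => [i'|]; last by rewrite del_gen_left // mul1g mulg1.
  case Ej: (unlift m j) => [j'|]; last by rewrite del_gen_right // mul1g mulg1.
  case Ek: (unlift m k) => [k'|];
    last by rewrite (del_gen_left kl) // mul1g mulg1.
  case El: (unlift m l) => [l'|];
    last by rewrite (del_gen_right kl) // mul1g mulg1.
  have ij' := monoE _ _ _ _ ij Ei Ej; have kl' := monoE _ _ _ _ kl Ek El.
  rewrite (del_gen_keep ij ij' Ei Ej) (del_gen_keep kl kl' Ek El).
  have H' : (j' < k') || (i' < k') && (l' < j').
    by rewrite (unlift_ltn Ej Ek) (unlift_ltn Ei Ek) (unlift_ltn El Ej).
  have := rel1 _ _ _ (braid_rel_comm ij' kl' H').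
  by rewrite /eval_word !big_map !big_cons !big_nil /= !mulg1.
- case Ei: (unlift m i) => [i'|];
    last by rewrite (del_gen_left ij) // (del_gen_left ik) // !mul1g mulg1.
  case Ej: (unlift m j) => [j'|];
    last by rewrite (del_gen_right ij) // (del_gen_left jk) // !mul1g mulg1.
  case Ek: (unlift m k) => [k'|];
    last by rewrite (del_gen_right ik) // (del_gen_right jk) // !mul1g !mulg1.
  have ij' := monoE _ _ _ _ ij Ei Ej; have jk' := monoE _ _ _ _ jk Ej Ek.
  have ik' := monoE _ _ _ _ ik Ei Ek.
  rewrite (del_gen_keep ij ij' Ei Ej) (del_gen_keep jk jk' Ej Ek).
  rewrite (del_gen_keep ik ik' Ei Ek).
  have := rel1 _ _ _ (braid_rel_three1 ij' jk' ik').
  by rewrite /eval_word !big_map !big_cons !big_nil /= !mulg1.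
- case Ei: (unlift m i) => [i'|];
    last by rewrite (del_gen_left ij) // (del_gen_left ik) // !mul1g !mulg1.
  case Ej: (unlift m j) => [j'|];
    last by rewrite (del_gen_right ij) // (del_gen_left jk) // !mul1g !mulg1.
  case Ek: (unlift m k) => [k'|];
    last by rewrite (del_gen_right ik) // (del_gen_right jk) // !mul1g !mulg1.
  have ij' := monoE _ _ _ _ ij Ei Ej; have jk' := monoE _ _ _ _ jk Ej Ek.
  have ik' := monoE _ _ _ _ ik Ei Ek.
  rewrite (del_gen_keep ij ij' Ei Ej) (del_gen_keep jk jk' Ej Ek).
  rewrite (del_gen_keep ik ik' Ei Ek).
  have := rel1 _ _ _ (braid_rel_three2 ij' jk' ik').
  by rewrite /eval_word !big_map !big_cons !big_nil /= !mulg1.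
- case Ej: (unlift m j) => [j'|];
    last by rewrite (del_gen_left jk) // (del_gen_left jl) // !mul1g !mulg1.
  case Ek: (unlift m k) => [k'|];
    last by rewrite (del_gen_right ik) // (del_gen_right jk) //
                    (del_gen_left kl) // !mul1g !mulg1.
  case El: (unlift m l) => [l'|];
    last by rewrite (del_gen_right jl) // (del_gen_right kl) // !mul1g !mulg1.
  have jk' := monoE _ _ _ _ jk Ej Ek; have kl' := monoE _ _ _ _ kl Ek El.
  have jl' := monoE _ _ _ _ jl Ej El.
  rewrite (del_gen_keep jk jk' Ej Ek) (del_gen_keep kl kl' Ek El).
  rewrite (del_gen_keep jl jl' Ej El).
  case Ei: (unlift m i) => [i'|].
    have ij' := monoE _ _ _ _ ij Ei Ej; have ik' := monoE _ _ _ _ ik Ei Ek.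
    rewrite (del_gen_keep ik ik' Ei Ek).
    have := rel1 _ _ _ (braid_rel_four ij' jk' kl' ik' jl').
    by rewrite /eval_word !big_map !big_cons !big_nil /= !mulg1.
  rewrite (del_gen_left ik) // !mul1g.
  have := rel1 _ _ _ (braid_rel_three2 jk' kl' jl').
  by rewrite /eval_word !big_map !big_cons !big_nil /= !mulg1.
Qed.

Definition strand_del n (m : 'I_n) : PB n -> PB n.-1 :=
  pres_lift (@del_gen_rel n m).

HB.instance Definition _ n (m : 'I_n) :=
  Multiplicative.on (@strand_del n m).

Definition brunnian n (beta : PB n) : Prop :=
  forall m : 'I_n, strand_del m beta = 1.

(** * The group G_n^3 *)

Definition triple (n : nat) := {A : {set 'I_n} | #|A| == 3}.

Inductive Gn3_rel n : word (triple n) -> word (triple n) -> Prop :=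
| Gn3_rel_sq (A : triple n) : Gn3_rel (positive [:: A; A]) [::]
| Gn3_rel_comm (A B : triple n) : #|val A :&: val B| < 2 ->
    Gn3_rel (positive [:: A; B]) (positive [:: B; A])
| Gn3_rel_tetra (i j k l : 'I_n) (A B C D : triple n) :
    uniq [:: i; j; k; l] ->
    val A = [set i; j; k] -> val B = [set i; j; l] ->
    val C = [set i; k; l] -> val D = [set j; k; l] ->
    Gn3_rel (positive [:: A; B; C; D]) (positive [:: D; C; B; A]).

Definition Gn3 (n : nat) := presented (@Gn3_rel n).

(* The generators are involutions, so that words without inverse letters
   represent all elements. *)
Definition Gn3_class n (v : seq (triple n)) : Gn3 n :=
  wclass (@Gn3_rel n) (positive v).

(* The value 1 is a default, for indices that are not distinct. *)
Definition a_gen n (i j k : 'I_n) : Gn3 n :=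
  if insub [set i; j; k] is Some A then pgen _ A else 1.

(** * The homomorphism from PB_n to G_n^3 *)

Definition c_elt n (i j : 'I_n) : Gn3 n :=
  (\prod_(k < n | j < k) a_gen i j k) *
  (\prod_(k < n | (k < j) && (k != i)) a_gen i j k).

Definition phi_gen n (g : braid_gen n) : Gn3 n :=
  let: (i, j) := val g in
  (\prod_(t <- enum 'I_n | i < t < j) (c_elt i t)^-1) * (c_elt i j) ^+ 2 *
  (\prod_(t <- rev (enum 'I_n) | i < t < j) c_elt i t).

(* The image phi_n(beta), computed from a word u that represents beta. *)
Definition phi_word n (u : word (braid_gen n)) : Gn3 n :=
  eval_word (@phi_gen n) u.

(** * The group F_n^3 and the invariant w_(i,j,k) *)

Section Invariant.
Variables (n : nat) (i j k : 'I_n).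

Definition F_gen := {ffun {l : 'I_n | l \notin [set i; j; k]} -> 'Z_2 * 'Z_2}.

Inductive F_rel : word F_gen -> word F_gen -> Prop :=
| F_rel_sq (s : F_gen) : F_rel (positive [:: s; s]) [::].

Definition Fn3 := presented F_rel.

Definition num_occ (p : seq (triple n)) (x y z : 'I_n) : 'Z_2 :=
  (count (fun A => val A == [set x; y; z]) p)%:R%R.

(* The generator i_c attached to an occurrence c, where p is the part of the
   word that precedes c. *)
Definition occ_gen (p : seq (triple n)) : F_gen :=
  [ffun l => (num_occ p j k (val l) + num_occ p i j (val l),
              num_occ p i k (val l) + num_occ p i j (val l))%R].

(* This makes sense for all words, in good condition or not. *)
Definition w_inv (v : seq (triple n)) : Fn3 :=
  \prod_(t < size v | val (tnth (in_tuple v) t) == [set i; j; k])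
    pgen F_rel (occ_gen (take t v)).

End Invariant.

(* Main.v *)
Require Import Defs.
From HB Require Import structures.
From mathcomp Require Import all_boot all_order all_algebra.

Set Implicit Arguments.
Unset Strict Implicit.
Unset Printing Implicit Defensive.

Import GRing.Theory.

Local Open Scope group_scope.

(** Write T = {i, j, k}.  An occurrence of a letter other than a_T acts on the
    generators of F_n^3 that later occurrences of a_T produce: the letter
    a_{x,y,l}, with x, y in T and l outside T, adds to their coordinate l a
    vector that depends only on the edge {x, y} of T, and every other letter
    leaves them alone.  Reading a word from a starting state s in place of 0
    therefore gives an element [cocycle x s] of F_n^3 with
      [cocycle (x * y) s = cocycle x s * cocycle y (s + shift x)],
    where [shift x] is the total translation caused by x.  The value at s = 0 is
    the invariant w ([w_inv_cocycle]).  The relations of G_n^3 preserve it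
    ([word_cocycle_rel]); the tetrahedron relation does so because the vectors
    of the three edges of T add up to zero.

    The element phi_n(b_pq) is a conjugate of the square of c_pq, so its shift
    vanishes.  Hence w o phi_n is multiplicative on braid words, and it is
    determined by its values f(p, q) on the generators b_pq ([cocycle_phi]).
    - If p or q lies outside T, then a_T does not occur in c_pq; conjugation
      cancels all other contributions and f(p, q) = 1 ([braid_val_out]).
    - If T = {a < b < c}, following the state through the three words gives
      involutions x, y, z of F_n^3 such that f(a, b) = x y, f(a, c) = y^-1 z and
      f(b, c) = z x; so f(a, b) f(a, c) f(b, c) = 1 ([braid_val_triangle]).

    Values of this shape on the generators of a pure braid group, on any number
    of strands, satisfy its defining relations ([braid_rel_triple]).  When there
    is a strand m outside T, this applies on the strands other than m, and f
    becomes the composite of p_m with a homomorphism; so it is trivial on a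
    Brunnian braid.  When T consists of all strands, F_n^3 has a single
    generator, each square of c_pq contains a_T exactly twice, and f is trivial
    altogether ([braid_val_triple_full]). *)

(** * Products and sums over ranges of strands *)

Lemma big_split_sorted (G : groupType) (T : eqType) (r : rel T) (s : seq T)
    (P : pred T) (F : T -> G) (b : T) :
    irreflexive r -> transitive r -> sorted r s -> b \in s -> P b ->
  \prod_(x <- s | P x) F x =
    \prod_(x <- s | P x && r x b) F x * F b *
    \prod_(x <- s | P x && r b x) F x.
Proof.
move=> rI rT rs bs Pb; case/splitPr: bs rs => s1 s2.
rewrite sorted_pairwise // pairwise_cat /= => /and4P[+ _ bs2 _].
rewrite allrel_consr => /andP[s1b _].
have asym x y : r x y -> r y x = false.
  by move=> xy; apply/negP => /(rT _ _ _ xy); rewrite rI.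
have lt1 : \prod_(x <- s1 | P x && r x b) F x = \prod_(x <- s1 | P x) F x.
  rewrite big_seq_cond [RHS]big_seq_cond; apply: eq_bigl => x.
  by case: (x \in s1) / idP => //= /(allP s1b) ->; rewrite andbT.
have gt2 : \prod_(x <- s2 | P x && r b x) F x = \prod_(x <- s2 | P x) F x.
  rewrite big_seq_cond [RHS]big_seq_cond; apply: eq_bigl => x.
  by case: (x \in s2) / idP => //= /(allP bs2) ->; rewrite andbT.
have lt2 : \prod_(x <- s2 | P x && r x b) F x = 1.
  by apply: big1_seq => x /andP[/andP[_ xb] /(allP bs2)/asym]; rewrite xb.
have gt1 : \prod_(x <- s1 | P x && r b x) F x = 1.
  by apply: big1_seq => x /andP[/andP[_ xb] /(allP s1b)/asym]; rewrite xb.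
by rewrite !big_cat !big_cons Pb rI /= lt1 lt2 gt1 gt2 mulg1 mul1g mulgA.
Qed.

Lemma enum_ord_sorted n : sorted (fun x y : 'I_n => x < y) (enum 'I_n).
Proof.
have := iota_ltn_sorted 0 n; rewrite -val_enum_ord.
by rewrite sorted_map.
Qed.

Lemma sum_pick n (V : nmodType) (P : pred 'I_n) (l : 'I_n) (v : V) :
  (\sum_(x | P x) (if x == l then v else 0) = if P l then v else 0)%R.
Proof.
rewrite -big_mkcondr; case: ifP => Pl; last first.
  by apply: big_pred0 => x; case: eqP => [->|]; rewrite ?Pl ?andbF.
rewrite (eq_bigl (pred1 l)) ?big_pred1_eq // => x /=.
by case: eqP => [->|]; rewrite ?Pl ?andbF.
Qed.

(** The two ranges are those of the two factors of c_pq; together they meet each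
    index other than p and q once. *)
Lemma sum_pick2 n (V : nmodType) (p q l : 'I_n) (v : V) : l != p -> l != q ->
  (\sum_(x < n | (q < x)%N) (if x == l then v else 0) +
   \sum_(x < n | (x < q)%N && (x != p)) (if x == l then v else 0) = v)%R.
Proof.
move=> lp lq; rewrite !sum_pick lp andbT.
by case: ltngtP lq => [||/val_inj->]; rewrite ?eqxx ?add0r ?addr0.
Qed.

(** * Homomorphisms that live on one triple of strands *)

(** A relation that involves four strands has a strand outside S, which makes
    enough letters trivial to leave either a tautology or a relation on three
    strands.  On the three strands of S, the words x y z, y z x and z x y are
    all trivial as soon as the first one is. *)
Lemma braid_rel_triple N (G : groupType) (S : {set 'I_N})
    (h : 'I_N -> 'I_N -> G)
    (f := fun g : braid_gen N => h (val g).1 (val g).2) :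
    #|S| <= 3 ->
    (forall p q, ~~ ((p \in S) && (q \in S)) -> h p q = 1) ->
    (forall a b c : 'I_N, a \in S -> b \in S -> c \in S -> a < b -> b < c ->
       h a b * h a c * h b c = 1) ->
  forall u v, braid_rel u v -> eval_word f u = eval_word f v.
Proof.
move=> S3 h1 tri u v.
have no4 (a b c d : 'I_N) : uniq [:: a; b; c; d] ->
    a \in S -> b \in S -> c \in S -> d \in S -> False.
  move=> U aS bS cS dS; suff: 4 <= #|S| by rewrite leqNgt ltnS S3.
  have /= <- := card_uniqP U; apply/subset_leq_card/subsetP => x.
  by rewrite !inE => /or4P[]/eqP->.
have rot1 (x y z : G) : x * (y * z) = 1 -> y * (z * x) = 1.
  by move/mulg1_eq => E; rewrite mulgA -E mulVg.
have tri3 a b c : a \in S -> b \in S -> c \in S -> a < b -> b < c ->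
    h a b * (h a c * h b c) = 1.
  by rewrite mulgA; apply: tri.
have out1 p q : p \notin S -> h p q = 1 by move=> pS; rewrite h1 // (negPf pS).
have out2 p q : q \notin S -> h p q = 1.
  by move=> qS; rewrite h1 // (negPf qS) andbF.
case=> [i j k l ij kl hA|i j k ij jk ik|i j k ij jk ik|i j k l ij jk kl ik jl];
  rewrite /eval_word !big_map !big_cons !big_nil /= !mulg1 /f /=.
- have U : uniq [:: i; j; k; l].
    rewrite /= !inE !negb_or -!(inj_eq val_inj) (ltn_eqF ij) (ltn_eqF kl).
    rewrite !andbT /=.
    case/orP: hA => [jk|/andP[ik lj]].
      rewrite (ltn_eqF (ltn_trans ij jk)) (ltn_eqF jk).
      rewrite (ltn_eqF (ltn_trans jk kl)).
      by rewrite (ltn_eqF (ltn_trans ij (ltn_trans jk kl))).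
    rewrite (ltn_eqF ik) (gtn_eqF lj) (gtn_eqF (ltn_trans kl lj)).
    by rewrite (ltn_eqF (ltn_trans ik kl)).
  have [iS|/out1->] := boolP (i \in S); last by rewrite mul1g mulg1.
  have [jS|/out2->] := boolP (j \in S); last by rewrite mul1g mulg1.
  have [kS|/out1->] := boolP (k \in S); last by rewrite mul1g mulg1.
  have [lS|/out2->] := boolP (l \in S); last by rewrite mul1g mulg1.
  by case: (no4 _ _ _ _ U).
- have [iS|iS] := boolP (i \in S); last by rewrite !(out1 i) // !mul1g mulg1.
  have [jS|jS] := boolP (j \in S); last first.
    by rewrite (out2 i j) // (out1 j) // mul1g !mulg1.
  have [kS|kS] := boolP (k \in S); last by rewrite !(out2 _ k) // !mul1g !mulg1.
  have E := tri3 i j k iS jS kS ij jk; have E' := rot1 _ _ _ E.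
  by rewrite E E'.
- have [iS|iS] := boolP (i \in S); last by rewrite !(out1 i) // !mul1g !mulg1.
  have [jS|jS] := boolP (j \in S); last first.
    by rewrite (out2 i j) // (out1 j) // !mul1g !mulg1.
  have [kS|kS] := boolP (k \in S); last by rewrite !(out2 _ k) // !mul1g !mulg1.
  have E := rot1 _ _ _ (tri3 i j k iS jS kS ij jk); have E' := rot1 _ _ _ E.
  by rewrite E E'.
- have [jS|jS] := boolP (j \in S); last first.
    by rewrite !(out1 j) // !mul1g !mulg1.
  have [kS|kS] := boolP (k \in S); last first.
    by rewrite !(out2 _ k) // !(out1 k) // !mul1g !mulg1.
  have [lS|lS] := boolP (l \in S); last by rewrite !(out2 _ l) // !mul1g !mulg1.
  have iS : i \notin S.
    apply/negP => iS; apply: (no4 _ _ _ _ _ iS jS kS lS).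
    rewrite /= !inE !negb_or -!(inj_eq val_inj) (ltn_eqF ij) (ltn_eqF jk).
    rewrite (ltn_eqF kl) (ltn_eqF ik) (ltn_eqF jl).
    by rewrite (ltn_eqF (ltn_trans ij jl)).
  rewrite (out1 i) // !mul1g.
  have E := rot1 _ _ _ (tri3 j k l jS kS lS jk kl); have E' := rot1 _ _ _ E.
  by rewrite E E'.
Qed.

(** * The translation caused by one letter *)

Lemma face_set (N : nat) (x y z l : 'I_N) :
  z != x -> z != y -> l |: ([set x; y; z] :\ z) = [set x; y; l].
Proof.
move=> zx zy; apply/setP => t; rewrite !inE orbC; congr orb.
by case: (eqVneq t z) => [->|_] /=; rewrite ?orbF // (negPf zx) (negPf zy).
Qed.

Section Cocycle.
Variables (n : nat) (i j k : 'I_n).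
Hypothesis ijk : uniq [:: i; j; k].

Let T : {set 'I_n} := [set i; j; k].
Let F := Fn3 i j k.

Lemma card_ijk : #|T| = 3.
Proof.
have := card_uniqP ijk; move=> /= <-; apply: eq_card => x.
by rewrite !inE orbA.
Qed.

(** The element of Z_2 x Z_2 attached to the edge of T opposite to c: it is
    (1, 0) for the edge jk, (0, 1) for ik and (1, 1) for ij. *)
Definition edge_vec (c : 'I_n) : 'Z_2 * 'Z_2 :=
  ((c == i)%:R + (c == k)%:R, (c == j)%:R + (c == k)%:R)%R.

(** All translations below are sums of these: the vector opposite to c, on the
    coordinates l that satisfy P. *)
Definition shift_on (c : 'I_n) (P : pred 'I_n) : F_gen i j k :=
  [ffun l => if P (val l) then edge_vec c else 0%R].

Lemma edge_vec_sum a b c : uniq [:: a; b; c] -> a \in T -> b \in T -> c \in T ->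
  (edge_vec a + edge_vec b + edge_vec c = 0)%R.
Proof.
move: ijk; rewrite /= !inE !negb_or !andbT -!orbA.
move=> /andP[/andP[ij ik] jk] /andP[/andP[ab ac] bc].
move=> /or3P[] /eqP ? /or3P[] /eqP ? /or3P[] /eqP ?; subst;
  try by rewrite eqxx in ab ac bc.
all: rewrite /edge_vec !eqxx ?(negPf ij) ?(negPf ik) ?(negPf jk).
all: rewrite ?(eq_sym j i) ?(eq_sym k i) ?(eq_sym k j).
all: rewrite ?(negPf ij) ?(negPf ik) ?(negPf jk).
all: by apply/eqP.
Qed.

Lemma Z2Z2_addss (z : 'Z_2 * 'Z_2) : (z + z = 0)%R.
Proof.
case: z => x y; have xx (t : 'Z_2) : (t + t = 0)%R.
  by apply: val_inj; case: t => -[|[|]].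
by rewrite -[LHS]/(x + x, y + y)%R !xx.
Qed.

(** Two-variable identities in Z_2 x Z_2 are decided by their 16 instances. *)
Lemma Z2Z2_check (P : 'Z_2 * 'Z_2 -> 'Z_2 * 'Z_2 -> bool) :
  all (fun x => all (P x) [:: (0, 0); (0, 1); (1, 0); (1, 1)]%R)
    [:: (0, 0); (0, 1); (1, 0); (1, 1)]%R -> forall x y, P x y.
Proof.
have mem4 (x : 'Z_2 * 'Z_2) : x \in [:: (0, 0); (0, 1); (1, 0); (1, 1)]%R.
  by case: x => -[[|[|//]] ?] [[|[|//]] ?].
by move=> /allP P4 x y; apply: (allP (P4 x (mem4 x))).
Qed.

Lemma edge_vec_add a b c : uniq [:: a; b; c] -> a \in T -> b \in T -> c \in T ->
  (edge_vec a + edge_vec b = edge_vec c)%R.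
Proof.
move=> abc aT bT cT.
rewrite -[LHS]addr0 -(Z2Z2_addss (edge_vec c)) addrA.
by rewrite (edge_vec_sum abc) // add0r.
Qed.

Lemma Fgen_addss (s : F_gen i j k) : (s + s = 0)%R.
Proof. by apply/ffunP => l; rewrite !ffunE Z2Z2_addss. Qed.

Lemma Fgen_addK (s t : F_gen i j k) : (s + t + t = s)%R.
Proof. by rewrite -addrA Fgen_addss addr0. Qed.

(** The set m |: (T :\ c) consists of the edge of T opposite to c and one
    vertex m; from outside T, both the edge and the vertex can be recovered. *)
Lemma face_eq (c z l m : 'I_n) : c \in T -> z \in T -> l \notin T ->
  (m |: (T :\ c) == l |: (T :\ z)) = (m == l) && (c == z).
Proof.
move=> cT zT lT; apply/eqP/andP=> [E|[/eqP-> /eqP->] //].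
have ml : m == l.
  move/setP: (E) => /(_ l); rewrite !inE eqxx eq_sym -in_set1.
  by move: lT; rewrite !inE => /negPf->; rewrite andbF orbF.
split=> //; rewrite {}(eqP ml) in E; move/setP: E => /(_ c).
rewrite !(in_setU1, in_setD1) eqxx cT /= andbT orbF.
have /negPf-> : c != l by apply: contraNneq lT => <-.
by move/esym/negbFE.
Qed.

Definition letter_shift (A : triple n) : F_gen i j k := occ_gen i j k [:: A].

Lemma letter_shiftE A l : letter_shift A l =
  ((val A == val l |: (T :\ i))%:R + (val A == val l |: (T :\ k))%:R,
   (val A == val l |: (T :\ j))%:R + (val A == val l |: (T :\ k))%:R)%R.
Proof.
move: ijk; rewrite /= !inE !negb_or !andbT => /andP[/andP[ij ik] jk].
have -> : val l |: (T :\ i) = [set j; k; val l].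
  apply/setP=> x; rewrite !inE [RHS]orbC; congr orb.
  by case: (eqVneq x i) => //= ->; rewrite (negPf ij) (negPf ik).
have -> : val l |: (T :\ j) = [set i; k; val l].
  apply/setP=> x; rewrite !inE [RHS]orbC; congr orb.
  case: (eqVneq x j) => //= [->|]; last by rewrite orbF.
  by rewrite eq_sym (negPf ij) (negPf jk).
have -> : val l |: (T :\ k) = [set i; j; val l].
  apply/setP=> x; rewrite !inE [RHS]orbC; congr orb.
  case: (eqVneq x k) => //= [->|]; last by rewrite orbF.
  by rewrite !(eq_sym k) (negPf ik) (negPf jk).
by rewrite ffunE /num_occ /= !addn0.
Qed.

Lemma letter_shift_face A c m : c \in T -> val A = m |: (T :\ c) ->
  letter_shift A = shift_on c (fun l => m == l).
Proof.
move=> cT AE; apply/ffunP => l; rewrite letter_shiftE [RHS]ffunE AE.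
have [iT [jT kT]] : i \in T /\ j \in T /\ k \in T by rewrite !inE !eqxx ?orbT.
rewrite !face_eq ?(valP l) //.
by case: eqP => //= _; rewrite !addr0.
Qed.

Lemma letter_shift_eq0 A :
    (forall c m, c \in T -> m \notin T -> val A != m |: (T :\ c)) ->
  letter_shift A = 0%R.
Proof.
move=> hA; apply/ffunP => l; rewrite letter_shiftE [RHS]ffunE.
have [iT [jT kT]] : i \in T /\ j \in T /\ k \in T by rewrite !inE !eqxx ?orbT.
have lT := valP l.
rewrite (negPf (hA i _ iT lT)) (negPf (hA j _ jT lT)).
by rewrite (negPf (hA k _ kT lT)) !addr0.
Qed.

(** * The crossed homomorphism on words *)

Definition letter_cocycle (A : triple n) (s : F_gen i j k) : F :=
  if val A == T then pgen _ s else 1.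

(** Inverse letters are read like the letters themselves, since generators of
    G_n^3 are involutions. *)
Definition word_shift (u : word (triple n)) : F_gen i j k :=
  (\sum_(x <- u) letter_shift x.1)%R.

Fixpoint word_cocycle (u : word (triple n)) (s : F_gen i j k) : F :=
  if u is x :: u' then
    letter_cocycle x.1 s * word_cocycle u' (s + letter_shift x.1)%R
  else 1.

Lemma word_shift_cat u v :
  (word_shift (u ++ v) = word_shift u + word_shift v)%R.
Proof. exact: big_cat. Qed.

Lemma word_cocycle_cat u v s : word_cocycle (u ++ v) s =
  word_cocycle u s * word_cocycle v (s + word_shift u)%R.
Proof.
elim: u s => [|x u IHu] s /=; first by rewrite /word_shift big_nil addr0 mul1g.
by rewrite IHu mulgA /word_shift big_cons addrA.
Qed.

Lemma pgenF2 (s : F_gen i j k) : pgen (@F_rel n i j k) s * pgen _ s = 1.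
Proof.
have := presented_rel (F_rel_sq s); rewrite !wclassE.
by rewrite /eval_word big_nil !big_cons big_nil /= mulg1.
Qed.

Lemma letter_cocycle2 A s : letter_cocycle A s * letter_cocycle A s = 1.
Proof.
by rewrite /letter_cocycle; case: ifP => _; rewrite ?mulg1 // pgenF2.
Qed.

Lemma face_capT c m : c \in T -> m \notin T -> #|(m |: (T :\ c)) :&: T| = 2.
Proof.
move=> cT mT; have -> : (m |: (T :\ c)) :&: T = T :\ c.
  apply/setP=> x; rewrite !(in_setI, in_setU1, in_setD1).
  case: (eqVneq x m) => [->|_] /=; first by rewrite (negPf mT) andbF.
  by rewrite -andbA andbb.
by have := cardsD1 c T; rewrite cT card_ijk => -[].
Qed.

Lemma letter_shift_small A : #|val A :&: T| != 2 -> letter_shift A = 0%R.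
Proof.
move=> hA; apply: letter_shift_eq0 => c m cT mT; apply: contraNneq hA => ->.
by rewrite face_capT.
Qed.

Lemma letter_shift_T A : val A = T -> letter_shift A = 0%R.
Proof. by move=> AT; apply: letter_shift_small; rewrite AT setIid card_ijk. Qed.

(** The three other faces of a tetrahedron with base T and apex l carry the
    three edge vectors in the same coordinate l. *)
Lemma letter_shift_tetra (x y z l : 'I_n) (A B C : triple n) :
    uniq [:: x; y; z; l] -> T = [set x; y; z] ->
    val A = [set x; y; l] -> val B = [set x; z; l] -> val C = [set y; z; l] ->
  (letter_shift A + letter_shift B + letter_shift C = 0)%R.
Proof.
move=> + TE AE BE CE.
rewrite /= !inE !negb_or !andbT -!andbA => /and5P[xy xz xl yz /andP[yl zl]].
have [xT yT zT] : [/\ x \in T, y \in T & z \in T].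
  by rewrite TE !inE !eqxx ?orbT.
have TE2 : T = [set x; z; y] by rewrite TE; apply/setP=> t; rewrite !inE orbAC.
have TE1 : T = [set y; z; x].
  by rewrite TE; apply/setP=> t; rewrite !inE -orbA orbC.
rewrite (@letter_shift_face A z l) //; last first.
  by rewrite AE TE face_set // eq_sym.
rewrite (@letter_shift_face B y l) //; last first.
  by rewrite BE TE2 face_set // eq_sym.
rewrite (@letter_shift_face C x l) //; last by rewrite CE TE1 face_set.
apply/ffunP => t; rewrite !ffunE; case: (l == val t); last by rewrite !addr0.
have xyz : uniq [:: x; y; z] by rewrite /= !inE negb_or xy xz yz.
rewrite -(edge_vec_sum xyz xT yT zT).
by rewrite -[LHS]addrA [LHS]addrC [(edge_vec y + _)%R]addrC.
Qed.

Lemma letter_cocycle_T (A : triple n) s :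
  val A = T -> letter_cocycle A s = pgen _ s.
Proof. by rewrite /letter_cocycle => ->; rewrite eqxx. Qed.

Lemma letter_cocycle_out (A : triple n) x s :
  x \in val A -> x \notin T -> letter_cocycle A s = 1.
Proof.
by rewrite /letter_cocycle => xA xT; case: eqP xT => // <-; rewrite xA.
Qed.

Lemma word_shift1 x : word_shift [:: x] = letter_shift x.1.
Proof. exact: big_seq1. Qed.

Lemma word_shift_cons x u :
  (word_shift (x :: u) = letter_shift x.1 + word_shift u)%R.
Proof. exact: big_cons. Qed.

(** * Invariance under the relations *)

Lemma Fgen_sum3 (a b c s : F_gen i j k) :
  (a + b + c = 0)%R -> (s + a = s + c + b)%R.
Proof.
move=> abc; have -> : a = (b + c)%R.
  by rewrite -[LHS]addr0 -(Fgen_addss (b + c)%R) !addrA abc add0r.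
by rewrite addrA addrAC.
Qed.

Lemma Fgen_sum0 (a b c s : F_gen i j k) :
  (a + b + c = 0)%R -> (s + c + b + a = s)%R.
Proof. by move=> /Fgen_sum3 <-; rewrite Fgen_addK. Qed.

(** At most one of the four faces is T, and only this letter contributes.  It is
    read in the state s plus the shifts of the letters before it; reversing the
    word exchanges the letters before and after it, and these have the same
    total shift because the shifts of the three other faces add up to zero. *)
Lemma word_cocycle_tetra (p q r l : 'I_n) (A B C D : triple n) s :
    uniq [:: p; q; r; l] ->
    val A = [set p; q; r] -> val B = [set p; q; l] ->
    val C = [set p; r; l] -> val D = [set q; r; l] ->
  word_cocycle (positive [:: A; B; C; D]) s =
    word_cocycle (positive [:: D; C; B; A]) s.
Proof.
move=> U AE BE CE DE; rewrite /= !mulg1.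
have [U1 U2 U3] : [/\ uniq [:: p; q; l; r], uniq [:: p; r; l; q] &
    uniq [:: q; r; l; p]].
  move: U; rewrite /= !inE !negb_or !andbT.
  move=> /and3P[/and3P[pq pr pl] /andP[qr ql] rl].
  rewrite !(eq_sym l r, eq_sym l q, eq_sym r q).
  by rewrite !(eq_sym q p, eq_sym r p, eq_sym l p) pq pr pl qr ql rl.
have notin3 x y z t : uniq [:: x; y; z; t] -> t \notin [set x; y; z].
  rewrite /= !inE !negb_or !andbT => /and3P[/and3P[_ _ xt] /andP[_ yt] zt].
  by rewrite !(eq_sym t) xt yt zt.
have out := letter_cocycle_out.
have [AT|nA] := eqVneq (val A) T.
  have lT : l \notin T by rewrite -AT AE; apply: notin3.
  have sum0 := letter_shift_tetra U (esym (etrans (esym AE) AT)) BE CE DE.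
  have [lB lC lD] : [/\ l \in val B, l \in val C & l \in val D].
    by rewrite BE CE DE !inE eqxx !orbT.
  rewrite !(out B l) // !(out C l) // !(out D l) // !mulg1 !mul1g.
  by rewrite !letter_cocycle_T // (Fgen_sum0 _ sum0).
have [BT|nB] := eqVneq (val B) T.
  have rT : r \notin T by rewrite -BT BE; apply: notin3.
  rewrite setUAC in CE; rewrite setUAC in DE.
  have sum0 := letter_shift_tetra U1 (esym (etrans (esym BE) BT)) AE CE DE.
  have [rA rC rD] : [/\ r \in val A, r \in val C & r \in val D].
    by rewrite AE CE DE !inE eqxx !orbT.
  rewrite !(out A r) // !(out C r) // !(out D r) // !mulg1 !mul1g.
  by rewrite !letter_cocycle_T // (Fgen_sum3 _ sum0).
have [CT|nC] := eqVneq (val C) T.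
  have qT : q \notin T by rewrite -CT CE; apply: notin3.
  rewrite setUAC in AE; rewrite setUAC in BE.
  rewrite -setUA setUC in DE.
  have sum0 := letter_shift_tetra U2 (esym (etrans (esym CE) CT)) AE BE DE.
  have [qA qB qD] : [/\ q \in val A, q \in val B & q \in val D].
    by rewrite AE BE DE !inE eqxx !orbT.
  rewrite !(out A q) // !(out B q) // !(out D q) // !mulg1 !mul1g.
  rewrite !letter_cocycle_T //; congr pgen.
  by rewrite -[in RHS](addr0 s) -sum0 !addrA Fgen_addK.
have [DT|nD] := eqVneq (val D) T.
  have pT : p \notin T by rewrite -DT DE; apply: notin3.
  rewrite -setUA setUC in AE; rewrite -setUA setUC in BE.
  rewrite -setUA setUC in CE.
  have sum0 := letter_shift_tetra U3 (esym (etrans (esym DE) DT)) AE BE CE.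
  have [pA pB pC] : [/\ p \in val A, p \in val B & p \in val C].
    by rewrite AE BE CE !inE eqxx !orbT.
  rewrite !(out A p) // !(out B p) // !(out C p) // !mulg1 !mul1g.
  rewrite !letter_cocycle_T // -!addrA [(letter_shift A + _)%R]addrA.
  by rewrite sum0 addr0.
by rewrite /letter_cocycle !ifN // !mulg1.
Qed.

Lemma word_cocycle_rel u v : Gn3_rel u v ->
  word_shift u = word_shift v /\ forall s, word_cocycle u s = word_cocycle v s.
Proof.
case=> [A|A B AB|p q r l A B C D U AE BE CE DE].
- split=> [|s].
    rewrite /positive /= !word_shift_cons /word_shift big_nil addr0.
    exact: Fgen_addss.
  rewrite /= mulg1; have [AT|nA] := eqVneq (val A) T.
    by rewrite letter_shift_T // addr0 letter_cocycle2.
  by rewrite /letter_cocycle !ifN // mulg1.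
- split=> [|s]; first by rewrite !word_shift_cons /= addrCA.
  rewrite /= !mulg1; have [AT|nA] := eqVneq (val A) T.
    have tB : letter_shift B = 0%R.
      apply: letter_shift_small; rewrite -AT setIC.
      by case: #|_| AB => [|[|[]]].
    have nB : val B != T.
      by apply: contraTneq AB => BT; rewrite AT BT setIid card_ijk.
    by rewrite tB addr0 /letter_cocycle !(ifN _ _ nB) mulg1 mul1g.
  have [BT|nB] := eqVneq (val B) T; last by rewrite /letter_cocycle !ifN.
  have tA : letter_shift A = 0%R.
    by apply: letter_shift_small; rewrite -BT; case: #|_| AB => [|[|[]]].
  by rewrite tA addr0 /letter_cocycle !(ifN _ _ nA) mulg1 mul1g.
- split=> [|s]; last exact: word_cocycle_tetra AE BE CE DE.
  rewrite !word_shift_cons /=.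
  rewrite /word_shift !big_nil !addr0 addrC [(letter_shift B + _)%R]addrC.
  by rewrite [(letter_shift C + _)%R]addrC !addrA.
Qed.

Lemma word_cocycle_eq u v : word_eq (@Gn3_rel n) u v ->
  word_shift u = word_shift v /\ forall s, word_cocycle u s = word_cocycle v s.
Proof.
elim=> {u v} [//|u v _ [-> uv]|u v w _ [-> uv] _ [-> vw]|p q x e|p q u v].
- by split=> // s; rewrite uv.
- by split=> // s; rewrite uv.
- have [tx hx] := word_cocycle_rel (Gn3_rel_sq x).
  have tE : word_shift [:: (x, e); (x, ~~ e)] = 0%R.
    by rewrite !word_shift_cons /word_shift big_nil addr0 Fgen_addss.
  rewrite !word_shift_cat tE add0r; split=> // s.
  rewrite !word_cocycle_cat tE addr0; congr (_ * _).
  by rewrite (hx _ : word_cocycle [:: (x, e); (x, ~~ e)] _ = 1) mul1g.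
- move=> /word_cocycle_rel[tuv huv]; rewrite !word_shift_cat tuv; split=> // s.
  by rewrite !word_cocycle_cat tuv huv.
Qed.

(** * The crossed homomorphism on the group *)

Definition shift (x : Gn3 n) : F_gen i j k := word_shift (repr x).
Definition cocycle (x : Gn3 n) (s : F_gen i j k) : F := word_cocycle (repr x) s.

Lemma shift_class u : shift (wclass _ u) = word_shift u.
Proof. exact: (word_cocycle_eq (wclass_reprE _ u)).1. Qed.

Lemma cocycle_class u s : cocycle (wclass _ u) s = word_cocycle u s.
Proof. exact: (word_cocycle_eq (wclass_reprE _ u)).2. Qed.

Lemma shift1 : shift 1 = 0%R.
Proof.
by rewrite -(wclass_nil (@Gn3_rel n)) shift_class /word_shift big_nil.
Qed.

Lemma cocycle1 s : cocycle 1 s = 1.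
Proof. by rewrite -(wclass_nil (@Gn3_rel n)) cocycle_class. Qed.

Lemma shiftM x y : shift (x * y) = (shift x + shift y)%R.
Proof.
rewrite -{1}(wclassK x) -{1}(wclassK y) -wclass_cat shift_class.
exact: word_shift_cat.
Qed.

Lemma cocycleM x y s :
  cocycle (x * y) s = cocycle x s * cocycle y (s + shift x)%R.
Proof.
rewrite -{1}(wclassK x) -{1}(wclassK y) -wclass_cat cocycle_class.
exact: word_cocycle_cat.
Qed.

Lemma shiftV x : shift x^-1 = shift x.
Proof. by rewrite -[LHS](Fgen_addK _ (shift x)) -shiftM mulVg shift1 add0r. Qed.

Lemma cocycleV x s : cocycle x^-1 s = (cocycle x (s + shift x)%R)^-1.
Proof.
apply/esym/mulg1_eq; rewrite -{2}(Fgen_addK s (shift x)).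
by rewrite -cocycleM mulgV cocycle1.
Qed.

Lemma shift_prod I (r : seq I) (P : pred I) (E : I -> Gn3 n) :
  shift (\prod_(x <- r | P x) E x) = (\sum_(x <- r | P x) shift (E x))%R.
Proof. exact: (big_morph _ shiftM shift1). Qed.

Lemma cocycle_prod1 I (r : seq I) (P : pred I) (E : I -> Gn3 n) s :
    (forall x t, P x -> cocycle (E x) t = 1) ->
  cocycle (\prod_(x <- r | P x) E x) s = 1.
Proof.
move=> H1; elim: r s => [|x r IHr] s; first by rewrite big_nil cocycle1.
by rewrite big_cons; case: ifP => // Px; rewrite cocycleM H1 // mul1g.
Qed.

Lemma shiftJ2 x y : shift ((x ^+ 2) ^ y) = 0%R.
Proof.
by rewrite conjgE expg2 !shiftM shiftV Fgen_addss add0r Fgen_addss.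
Qed.

(** The square has shift zero, so the conjugating element is read twice from the
    same state and contributes an honest conjugation. *)
Lemma cocycleJ2 x y s (t := (s + shift y)%R) :
  cocycle ((x ^+ 2) ^ y) s =
    (cocycle x t * cocycle x (t + shift x)%R) ^ (cocycle y t).
Proof.
rewrite conjgE expg2 !cocycleM shiftM shiftV cocycleV -/t Fgen_addss addr0.
by rewrite conjgE !mulgA.
Qed.

Lemma a_genAC x y z : @a_gen n x y z = a_gen x z y.
Proof. by rewrite /a_gen setUAC. Qed.

Lemma shift_pgen A : shift (pgen _ A) = letter_shift A.
Proof. by rewrite shift_class word_shift1. Qed.

Lemma cocycle_pgen A s : cocycle (pgen _ A) s = letter_cocycle A s.
Proof. by rewrite cocycle_class /= mulg1. Qed.

Lemma cocycle_out x y z t s :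
  t \in [set x; y; z] -> t \notin T -> cocycle (a_gen x y z) s = 1.
Proof.
move=> txyz tT; rewrite /a_gen.
case: insubP => [A _ AE|_]; last exact: cocycle1.
by rewrite cocycle_pgen; apply: (@letter_cocycle_out A t); rewrite ?AE.
Qed.

Lemma cocycle_T x y z s :
  [set x; y; z] = T -> cocycle (a_gen x y z) s = pgen _ s.
Proof.
move=> E; rewrite /a_gen; case: insubP => [A _ AE|]; last by rewrite E card_ijk.
by rewrite cocycle_pgen letter_cocycle_T // AE.
Qed.

(** Every letter of c_pq contains p and q, so none is a_T if one of p and q is
    outside T. *)
Lemma c_elt_inert p q s :
  ~~ ((p \in T) && (q \in T)) -> cocycle (c_elt p q) s = 1.
Proof.
rewrite negb_and => pqT.
have out x t : cocycle (a_gen p q x) t = 1.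
  case/orP: pqT => [pT|qT].
    by apply: (cocycle_out _ _ pT); rewrite !inE eqxx.
  by apply: (cocycle_out _ _ qT); rewrite !inE eqxx orbT.
by rewrite /c_elt cocycleM !cocycle_prod1 ?mulg1.
Qed.

(** * Values on the elements c_ij *)

Section Row.
Variables (a b c : 'I_n).
Hypotheses (abc : uniq [:: a; b; c]).
Hypotheses (aT : a \in T) (bT : b \in T) (cT : c \in T).

Lemma triple_eqT : [set a; b; c] = T.
Proof.
apply/eqP; rewrite eqEcard card_ijk; apply/andP; split.
  apply/subsetP => x; rewrite !inE -orbA => /or3P[]/eqP->;
    by rewrite -?in_set1 -?in_setU.
have := card_uniqP abc; move=> /= <-; rewrite subset_leq_card //.
by apply/subsetP => x; rewrite !inE orbA.
Qed.

(** This also covers m = a and m = b, where [a_gen] takes its default value 1,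
    and m = c, which is not a coordinate. *)
Lemma shift_a_gen m :
  shift (a_gen a b m) = shift_on c (fun l => m == l).
Proof.
move: (abc); rewrite /= !inE !negb_or !andbT => /andP[/andP[ab ac] bc].
rewrite /a_gen; case: insubP => [A _ AE|ncard].
  rewrite shift_pgen; apply: letter_shift_face => //.
  by rewrite -triple_eqT face_set // eq_sym.
rewrite shift1; apply/ffunP => l; rewrite !ffunE; case: eqP => // ml.
case/eqP: ncard; have := card_uniqP (_ : uniq [:: a; b; m]); rewrite /= => <-.
  by apply: eq_card => x; rewrite !inE orbA.
have mT : m \notin T by rewrite ml (valP l).
rewrite !inE negb_or ab /= andbT.
by apply/andP; split; apply: contraNneq mT => <-.
Qed.

Lemma shift_row (P : pred 'I_n) :
  shift (\prod_(x | P x) a_gen a b x) = shift_on c P.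
Proof.
rewrite shift_prod; apply/ffunP => l; rewrite sum_ffunE [RHS]ffunE -sum_pick.
by apply: eq_bigr => x _; rewrite shift_a_gen ffunE.
Qed.

Lemma shift_c_elt : shift (c_elt a b) = shift_on c predT.
Proof.
rewrite /c_elt shiftM !shift_prod; apply/ffunP => l; rewrite !ffunE !sum_ffunE.
rewrite -[RHS](@sum_pick2 _ _ a b (val l)).
- by congr (_ + _)%R; apply: eq_bigr => x _; rewrite shift_a_gen ffunE.
- by apply: contraNneq (valP l) => ->.
- by apply: contraNneq (valP l) => ->.
Qed.

Lemma cocycle_row_out (P : pred 'I_n) s :
  ~~ P c -> cocycle (\prod_(x | P x) a_gen a b x) s = 1.
Proof.
move=> Pc; apply: cocycle_prod1 => x t Px.
have xc : x != c by apply: contraNneq Pc => <-.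
have [xT|xT] := boolP (x \in T); last first.
  by apply: (cocycle_out _ _ xT); rewrite !inE eqxx !orbT.
rewrite /a_gen; case: insubP => [A _ AE|_]; last exact: cocycle1.
rewrite cocycle_pgen /letter_cocycle; case: eqP => // AT.
have : c \in [set a; b; x] by rewrite -AE AT.
move: (abc); rewrite /= !inE !negb_or !andbT => /andP[/andP[_ ac] bc].
by rewrite !(eq_sym c) (negPf ac) (negPf bc) (negPf xc).
Qed.

Lemma cocycle_row (P : pred 'I_n) s : P c ->
  cocycle (\prod_(x | P x) a_gen a b x) s =
    pgen _ (s + shift_on c (fun l => P l && (l < c)%N))%R.
Proof.
move=> Pc.
have ltrr : irreflexive (fun x y : 'I_n => x < y) by move=> x; apply: ltnn.
have lttr : transitive (fun x y : 'I_n => x < y).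
  by move=> x y z; apply: ltn_trans.
have sr : sorted (fun x y : 'I_n => x < y) (index_enum 'I_n).
  by rewrite [index_enum _]unlock -enumT enum_ord_sorted.
rewrite (big_split_sorted _ ltrr lttr sr (mem_index_enum c)) //.
rewrite -mulgA cocycleM cocycle_row_out ?ltnn ?andbF // mul1g.
rewrite cocycleM cocycle_row_out ?ltnn ?andbF // mulg1 shift_row.
by rewrite cocycle_T ?triple_eqT.
Qed.

(** The open interval from p to q in the cyclic order: the second factor of c_ab
    continues past the last strand with the first one. *)
Definition cyc_between (p q l : nat) :=
  if p < q then p < l < q else (p < l) || (l < q).

(** The letters of c_ab before a_abc are the a_abl for which l is met before c
    in the cyclic order that starts after b. *)
Lemma cocycle_c_elt s : cocycle (c_elt a b) s =
  pgen _ (s + shift_on c (cyc_between b c))%R.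
Proof.
move: (abc); rewrite /= !inE !negb_or !andbT => /andP[/andP[ab ac] bc].
rewrite /c_elt cocycleM; have [lbc|lcb] := ltnP b c.
  rewrite cocycle_row // cocycle_row_out ?mulg1; last first.
    by rewrite ltnNge (ltnW lbc).
  congr (pgen _ (_ + _)%R); apply/ffunP => l.
  by rewrite !ffunE /cyc_between lbc.
have {}lcb : c < b by rewrite ltn_neqAle eq_sym bc.
rewrite cocycle_row_out -?leqNgt 1?ltnW // mul1g cocycle_row ?lcb 1?eq_sym //.
rewrite shift_row -addrA; congr (pgen _ (_ + _)%R).
apply/ffunP => l; rewrite !ffunE /cyc_between (ltnNge b c) (ltnW lcb) /=.
have la : val l != a by apply: contraNneq (valP l) => ->.
have lb : val l != b by apply: contraNneq (valP l) => ->.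
rewrite la andbT; case: (ltngtP (val l) b) lb => [_ _|_ _|/val_inj ->].
- exact: add0r.
- exact: addr0.
- by rewrite eqxx.
Qed.

End Row.

Section Row2.
Variables (a b c : 'I_n).
Hypotheses (abc : uniq [:: a; b; c]).
Hypotheses (aT : a \in T) (bT : b \in T) (cT : c \in T).

Lemma shift_a_gen_out t x : t \notin T ->
  shift (a_gen a t x) = (shift_on c (fun l => (x == b) && (t == l)) +
                        shift_on b (fun l => (x == c) && (t == l)))%R.
Proof.
move=> tT; move: (abc).
rewrite /= !inE !negb_or !andbT => /andP[/andP[ab ac] bc].
have acb : uniq [:: a; c; b] by rewrite /= !inE !negb_or ab ac eq_sym bc.
have [->|xb] := eqVneq x b.
  rewrite a_genAC (shift_a_gen abc) //.
  by apply/ffunP => l; rewrite !ffunE (negPf bc) addr0.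
have [->|xc] := eqVneq x c.
  rewrite a_genAC (shift_a_gen acb) //.
  by apply/ffunP => l; rewrite !ffunE add0r.
rewrite /a_gen; case: insubP => [A _ AE|_]; last first.
  by rewrite shift1; apply/ffunP => l; rewrite !ffunE addr0.
rewrite shift_pgen letter_shift_small.
  by apply/ffunP => l; rewrite !ffunE addr0.
rewrite AE neq_ltn ltnS -(cards1 a) subset_leq_card //; apply/subsetP => y.
rewrite -(triple_eqT abc) // in tT *; rewrite !inE in tT *.
case/andP=> /orP[/orP[//|/eqP->]|/eqP->]; first by rewrite (negPf tT).
by rewrite (negPf xb) (negPf xc) !orbF.
Qed.

(** Only the letters a_{a,t,b} and a_{a,t,c} act; they act on the coordinate t,
    by the vectors opposite to c and b, whose sum is the vector opposite to a. *)
Lemma shift_c_elt_out t : t \notin T ->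
  shift (c_elt a t) = shift_on a (fun l => t == l).
Proof.
move=> tT; rewrite /c_elt shiftM !shift_prod.
apply/ffunP => l; rewrite !ffunE !sum_ffunE.
pose f z v x : 'Z_2 * 'Z_2 := if x == z :> 'I_n then v else 0%R.
pose vb := if t == val l then edge_vec b else 0%R.
pose vc := if t == val l then edge_vec c else 0%R.
have E x : shift (a_gen a t x) l = (f b vc x + f c vb x)%R.
  rewrite shift_a_gen_out // !ffunE /f /vb /vc.
  by case: (x == b); case: (x == c).
rewrite !(eq_bigr _ (fun x _ => E x)) !big_split /= addrACA.
move: (abc); rewrite /= !inE !negb_or !andbT => /andP[/andP[ab ac] bc].
have bt : b != t by apply: contraNneq tT => <-.
have ct : c != t by apply: contraNneq tT => <-.
rewrite eq_sym in ab; rewrite eq_sym in ac.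
rewrite !sum_pick2 //.
rewrite /vb /vc; case: eqP => _; last by rewrite addr0.
rewrite addrC (edge_vec_add (_ : uniq [:: b; c; a])) //=.
by rewrite !inE negb_or bc ab ac.
Qed.

End Row2.

(** * Values on the images of the braid generators *)

Definition row_prod (a : 'I_n) (P : pred 'I_n) : Gn3 n :=
  \prod_(t <- rev (enum 'I_n) | P t) c_elt a t.

Definition phi_pair (p q : 'I_n) : Gn3 n :=
  (c_elt p q ^+ 2) ^ row_prod p (fun t => p < t < q).

Lemma phi_genE g : phi_gen g = phi_pair (val g).1 (val g).2.
Proof. by case: g => -[p q] pq; rewrite /phi_gen /= prodgV -mulgA. Qed.

Definition braid_val p q := cocycle (phi_pair p q) 0%R.

Lemma braid_val_out p q : ~~ ((p \in T) && (q \in T)) -> braid_val p q = 1.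
Proof.
by move=> pq; rewrite /braid_val cocycleJ2 !c_elt_inert // mulg1 conj1g.
Qed.

Lemma cocycle_row_prod a (P : pred 'I_n) s : (forall t, P t -> t \notin T) ->
  cocycle (row_prod a P) s = 1.
Proof.
move=> PT; apply: cocycle_prod1 => t x /PT tT.
by rewrite c_elt_inert // negb_and tT orbT.
Qed.

Lemma shift_row_prod a b c (P : pred 'I_n) :
    uniq [:: a; b; c] -> a \in T -> b \in T -> c \in T ->
    (forall t, P t -> t \notin T) ->
  shift (row_prod a P) = shift_on a P.
Proof.
move=> abc aT bT cT PT; rewrite shift_prod (perm_big (enum 'I_n)) ?perm_rev //=.
rewrite big_enum_cond /=; apply/ffunP => l; rewrite sum_ffunE ffunE -sum_pick.
by apply: eq_bigr => t /PT tT; rewrite (shift_c_elt_out abc) // ffunE.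
Qed.

(** The state in which phi_n(b_ab) first meets the letter a_abc, when c is not
    between a and b: the first summand comes from the conjugating elements c_at
    with a < t < b, the second from the beginning of c_ab. *)
Definition crossing_state (a b c : 'I_n) : F_gen i j k :=
  (shift_on a (fun l => a < l < b)%N + shift_on c (cyc_between b c))%R.

(** The conjugating elements c_at do not contain a_abc, so the two occurrences
    in the square of c_ab are the only ones, one full shift of c_ab apart. *)
Lemma braid_val_adjacent a b c :
    uniq [:: a; b; c] -> a \in T -> b \in T -> c \in T ->
    ~~ (a < c < b) ->
  braid_val a b = pgen _ (crossing_state a b c) *
                  pgen _ (crossing_state a b c + shift_on c predT)%R.
Proof.
move=> abc aT bT cT acb.
have PT (t : 'I_n) : a < t < b -> t \notin T.
  move=> /andP[lat ltb].
  rewrite -(triple_eqT abc) // !inE !negb_or -!(inj_eq val_inj).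
  rewrite (gtn_eqF lat) (ltn_eqF ltb) /=; apply: contraNneq acb => <-.
  by rewrite lat ltb.
rewrite /braid_val cocycleJ2 cocycle_row_prod // conjg1.
rewrite !(cocycle_c_elt abc) // (shift_c_elt abc) //.
rewrite (shift_row_prod abc) // add0r.
by rewrite (addrAC _ _ (shift_on c (cyc_between b c))).
Qed.

(** Here t is the state reached by phi_n(b_ac) after its first part
    (c_{a,a+1})^-1 ... (c_{a,c-1})^-1, which contains (c_ab)^-1.  These
    identities say that all occurrences of a_abc in phi_n(b_ab), phi_n(b_ac) and
    phi_n(b_bc) are read in only three different states.  They are checked
    coordinate by coordinate, according to the position of l with respect to a,
    b and c. *)
Lemma crossing_states (a b c : 'I_n) (s := crossing_state a b c)
    (s' := crossing_state b c a)
    (t1 := shift_on a (fun l => (a < l < c) && (b < l))%N)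
    (t2 := shift_on a (fun l => (a < l < c) && (l < b))%N)
    (t := (t1 + shift_on c predT + t2)%R) :
    uniq [:: a; b; c] -> a \in T -> b \in T -> c \in T -> a < b -> b < c ->
  [/\ (s' + shift_on a predT = s)%R,
      (t + t1 + shift_on c (cyc_between b c) = s + shift_on c predT)%R,
      (t + shift_on b (cyc_between c b) = s')%R &
      (t + shift_on b predT + shift_on b (cyc_between c b) =
        s + shift_on c predT)%R].
Proof.
move=> abc aT bT cT ab bc; have ac := ltn_trans ab bc.
rewrite /t /t1 /t2 /s /s' /crossing_state.
split; apply/ffunP => l; have := valP l.
all: rewrite -[_ \notin _]/(val l \notin T) -(triple_eqT abc) // !inE !negb_or.
all: rewrite -andbA => /and3P[la lb lc]; rewrite !ffunE /cyc_between.
all: rewrite ?bc ?(ltnNge c a) ?(ltnW ac) ?(ltnNge c b) ?(ltnW bc) /=.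
all: have nlt (x y : 'I_n) : x != y -> (x < y) = ~~ (y < x)
       by move=> xy; rewrite -leqNgt ltn_neqAle xy.
all: rewrite ?(nlt _ a la) ?(nlt _ b lb) ?(nlt _ c lc) -(edge_vec_add abc) //.
all: have := @ltn_trans b a (val l) ab; have := @ltn_trans c b (val l) bc.
all: case: (a < val l); case: (b < val l); case: (c < val l) => /= r q;
  try (by move: (r isT)); try (by move: (q isT)).
all: apply/eqP; move: (edge_vec a) (edge_vec b).
all: match goal with |- forall x y, is_true (@?P x y) =>
  exact: (@Z2Z2_check P) end.
Qed.

(** With x, y, z the generators for the states s, s + T_ab and s', where T_ab is
    the shift of c_ab, the three values are x y, y^-1 (z y) y and z x. *)
Lemma braid_val_triangle a b c :
    a \in T -> b \in T -> c \in T -> a < b -> b < c ->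
  braid_val a b * braid_val a c * braid_val b c = 1.
Proof.
move=> aT bT cT ab bc; have ac := ltn_trans ab bc.
have abc : uniq [:: a; b; c].
  by rewrite /= !inE !negb_or -!(inj_eq val_inj) !ltn_eqF.
have bca : uniq [:: b; c; a].
  by rewrite /= !inE !negb_or -!(inj_eq val_inj) (ltn_eqF bc) !gtn_eqF.
have acb : uniq [:: a; c; b].
  by rewrite /= !inE !negb_or -!(inj_eq val_inj) (gtn_eqF bc) !ltn_eqF.
rewrite (braid_val_adjacent abc) //; last first.
  by rewrite negb_and -!leqNgt (ltnW bc) orbT.
rewrite (braid_val_adjacent bca) //; last first.
  by rewrite negb_and -!leqNgt (ltnW ab).
(* Since b lies between a and c, the conjugating element of phi_n(b_ac) does
   contain a_abc, once, in its factor c_ab. *)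
pose D1 := row_prod a (fun t => (a < t < c) && (b < t)).
pose D2 := row_prod a (fun t => (a < t < c) && (t < b)).
have yE : row_prod a (fun t => a < t < c) = D1 * c_elt a b * D2.
  have gtrr : irreflexive (fun x y : 'I_n => y < x) by move=> x; apply: ltnn.
  have gttr : transitive (fun x y : 'I_n => y < x).
    by move=> x y z xy yz; apply: ltn_trans yz xy.
  have sr : sorted (fun x y : 'I_n => y < x) (rev (enum 'I_n)).
    by rewrite rev_sorted enum_ord_sorted.
  have br : b \in rev (enum 'I_n) by rewrite mem_rev mem_enum.
  by rewrite /row_prod (big_split_sorted _ gtrr gttr sr br) // ab bc.
have outT (t : 'I_n) : t != a :> nat -> t != b :> nat -> t != c :> nat ->
    t \notin T.
  by rewrite -(triple_eqT abc) // !inE !negb_or !(inj_eq val_inj) => -> -> ->.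
have P1 (t : 'I_n) : (a < t < c) && (b < t) -> t \notin T.
  by case/andP=> /andP[lat ltc] lbt; apply: outT;
    rewrite ?(gtn_eqF lat) ?(gtn_eqF lbt) ?(ltn_eqF ltc).
have P2 (t : 'I_n) : (a < t < c) && (t < b) -> t \notin T.
  by case/andP=> /andP[lat ltc] ltb; apply: outT;
    rewrite ?(gtn_eqF lat) ?(ltn_eqF ltb) ?(ltn_eqF ltc).
have tD1 : shift D1 = _ := shift_row_prod abc aT bT cT P1.
have tD2 : shift D2 = _ := shift_row_prod abc aT bT cT P2.
pose t := (0 + shift (row_prod a (fun t => a < t < c)%N))%R.
have tE : t = (shift D1 + shift_on c predT + shift D2)%R.
  by rewrite /t add0r yE (shiftM _ D2) (shiftM D1) (shift_c_elt abc).
have := crossing_states abc aT bT cT ab bc; rewrite -tD1 -tD2 -tE.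
case=> E1 E2 E3 E4.
have yt : cocycle (row_prod a (fun t => a < t < c)) t =
    pgen _ (crossing_state a b c + shift_on c predT)%R.
  rewrite yE (cocycleM _ D2) (cocycleM D1) !cocycle_row_prod // mul1g mulg1.
  by rewrite (cocycle_c_elt abc) // E2.
rewrite E1 /braid_val cocycleJ2 -/t yt (shift_c_elt acb) //.
rewrite !(cocycle_c_elt acb) // E3 E4.
have pK (s : F_gen i j k) (x : F) : pgen _ s * (pgen _ s * x) = x.
  by rewrite mulgA pgenF2 mul1g.
by rewrite conjgE !mulgA mulgK -!mulgA !pK pgenF2.
Qed.

(** Without strands outside T there are no coordinates. *)
Lemma Fgen_singleton (s t : F_gen i j k) : (forall m, m \in T) -> s = t.
Proof. by move=> TT; apply/ffunP => l; have := valP l; rewrite TT. Qed.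

Lemma braid_val_triple_full (p q : 'I_n) :
  (forall m, m \in T) -> p < q -> braid_val p q = 1.
Proof.
move=> TT pq; have pT := TT p; have qT := TT q.
have [c] : exists c, c \in T :\ p :\ q.
  have T2 : #|T :\ p| = 2 by have := cardsD1 p T; rewrite pT card_ijk => -[].
  have qTp : q \in T :\ p by rewrite in_setD1 qT -(inj_eq val_inj) gtn_eqF.
  apply/card_gt0P; have := cardsD1 q (T :\ p).
  by rewrite T2 qTp => -[/esym E]; rewrite (E : #|_| = 1%N).
rewrite !in_setD1 => /and3P[cq cp cT].
have pqc : uniq [:: p; q; c].
  by rewrite /= !inE !negb_or !(eq_sym _ c) cq cp -(inj_eq val_inj) ltn_eqF.
have one (s t : F_gen i j k) : pgen (@F_rel n i j k) s * pgen _ t = 1.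
  by rewrite (Fgen_singleton s t TT) pgenF2.
by rewrite /braid_val cocycleJ2 !(cocycle_c_elt pqc) // one conj1g.
Qed.

Lemma occ_gen_shift v : occ_gen i j k v = word_shift (positive v).
Proof.
elim: v => [|A v IHv].
  rewrite /word_shift big_nil; apply/ffunP => l.
  by rewrite !ffunE /num_occ /= mulr0n !addr0.
rewrite /= word_shift_cons -IHv; apply/ffunP => l; rewrite !ffunE /num_occ /=.
rewrite -[RHS]/(_ + _, _ + _)%R /= !addn0 !natrD.
by congr (_, _); rewrite addrACA.
Qed.

(** The factors of w depend on the prefixes of the word, which a last letter
    does not change; hence the induction from the right. *)
Lemma w_inv_cocycle v : w_inv i j k v = word_cocycle (positive v) 0%R.
Proof.
case: v => [|A0 v0]; first by rewrite /w_inv big_ord0.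
(* A0 remains as the default value that [nth] needs. *)
move: (A0 :: v0) => {v0} v.
have -> : w_inv i j k v = \prod_(0 <= t < size v | val (nth A0 v t) == T)
    pgen _ (occ_gen i j k (take t v)).
  rewrite big_mkord /w_inv; apply: eq_bigl => t.
  by rewrite (tnth_nth A0).
elim/last_ind: v => [|v A IHv]; first by rewrite big_geq.
rewrite size_rcons big_mkcond big_nat_recr //= -big_mkcond /=.
rewrite nth_rcons ltnn eqxx -cats1 take_size_cat // /positive map_cat.
rewrite word_cocycle_cat.
congr (_ * _); last first.
  by rewrite /= mulg1 add0r occ_gen_shift.
rewrite -IHv big_nat_cond [RHS]big_nat_cond; apply: eq_big => t.
  by case: (ltnP t (size v)) => // tv; rewrite nth_cat tv.
by move=> /andP[/andP[_ tv] _]; rewrite takel_cat // ltnW.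
Qed.

(** Each phi_n(b_pq) brings the state 0 back to 0. *)
Lemma cocycle_phi u : cocycle (phi_word u) 0%R =
  eval_word (fun g : braid_gen n => braid_val (val g).1 (val g).2) u.
Proof.
elim: u => [|[g e] u IHu].
  by rewrite /phi_word /eval_word !big_nil cocycle1.
have tg : shift (phi_gen g) = 0%R by rewrite phi_genE shiftJ2.
have te : shift (if e then (phi_gen g)^-1 else phi_gen g) = 0%R.
  by case: (e); rewrite ?shiftV.
rewrite /phi_word /eval_word !big_cons cocycleM // te addr0 IHu; congr (_ * _).
rewrite /= /braid_val -phi_genE; case: (e) => //.
by rewrite cocycleV // tg addr0.
Qed.

End Cocycle.

(** * Brunnian braids *)

Theorem lemma4p5 (n : nat) (n_ge3 : 3 <= n) (i j k : 'I_n)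
    (ijk_distinct : uniq [:: i; j; k])
    (beta : PB n) (beta_brunnian : brunnian beta)
    (* u is any word that represents beta, v any word that represents
       the image of beta under phi_n *)
    (u : word (braid_gen n)) (u_beta : PB_class u = beta)
    (v : seq (triple n))
    (v_phi : Gn3_class v = phi_word u) :
  w_inv i j k v = 1.
Proof.
set T := [set i; j; k].
pose f (g : braid_gen n) := braid_val i j k (val g).1 (val g).2.
rewrite w_inv_cocycle -cocycle_class // -[wclass _ _]/(Gn3_class v) v_phi.
rewrite cocycle_phi // -/f.
have [[m mT]|allT] : (exists m, m \notin T) \/ (forall m, m \in T).
  case: (pickP [pred m | m \notin T]) => [m mT|none]; [left|right] => //.
    by exists m.
  by move=> m; have /negbFE := none m.
- (* The homomorphism on the strands other than m through which f factors. *)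
  pose h (p q : 'I_n.-1) := braid_val i j k (lift m p) (lift m q).
  have hR : forall u v, braid_rel u v ->
      eval_word (fun g : braid_gen n.-1 => h (val g).1 (val g).2) u =
      eval_word (fun g : braid_gen n.-1 => h (val g).1 (val g).2) v.
    have inS p : (p \in [set q | lift m q \in T]) = (lift m p \in T).
      by rewrite [LHS]in_set.
    apply: (@braid_rel_triple _ _ [set p | lift m p \in T]).
    - rewrite -(card_imset _ (@lift_inj _ m)) -(card_ijk ijk_distinct).
      apply/subset_leq_card/subsetP => _ /imsetP[p + ->].
      by rewrite inS.
    - by move=> p q; rewrite !inS => pq; apply: braid_val_out.
    - move=> a b c; rewrite !inS => aT bT cT ab bc.
      by apply: braid_val_triangle => //=; rewrite ltnNge leq_bump2 -ltnNge.
  have fE g : f g = pres_lift hR (del_gen m g).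
    case: g => -[p q] pq.
    rewrite -[exist _ _ _]/(bgen pq) {1}/f /=.
    case Ep: (unlift m p) => [p'|]; last first.
      rewrite del_gen_left // [RHS]gmulf1 braid_val_out //.
      by move: Ep; case: unliftP => // -> _; rewrite (negPf mT).
    case Eq: (unlift m q) => [q'|]; last first.
      rewrite del_gen_right // [RHS]gmulf1 braid_val_out //.
      by move: Eq; case: unliftP => // -> _; rewrite (negPf mT) andbF.
    have pq' : p' < q' by rewrite (unlift_ltn Ep Eq).
    rewrite (del_gen_keep pq pq' Ep Eq) pres_lift_pgen /h /=.
    move: Ep Eq; case: unliftP => // a -> [<-].
    by case: unliftP => // b -> [<-].
  have -> : eval_word f u = pres_lift hR (eval_word (del_gen m) u).
    rewrite /eval_word gmulf_prod; apply: eq_bigr => -[g e] _ /=.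
    by rewrite fE; case: e => //; rewrite gmulfV.
  have := beta_brunnian m; rewrite -u_beta /strand_del pres_lift_wclass => ->.
  exact: gmulf1.
- rewrite /eval_word big1 // => -[[[p q] pq] e] _ /=.
  have fpq : f (exist _ (p, q) pq) = 1 by apply: braid_val_triple_full.
  by case: e; rewrite fpq ?invg1.
Qed.
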